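(* Let $X$ be a Hausdorff topological space and $\mathcal{H}$ a complex separable Hilbert space. Then the $C^*$-convex hull of the set of Dirac spectral measures $\{\delta_x(\cdot)I_{\mathcal{H}} : x\in X\}$ is dense in $\mathcal{P}_{\mathcal{H}}(X)$ with respect to the bounded weak topology. In particular, the $C^*$-convex hull of the set of all $C^*$-extreme points of $\mathcal{P}_{\mathcal{H}}(X)$ is dense in $\mathcal{P}_{\mathcal{H}}(X)$ with respect to the bounded weak topology.
   Context: $X$ is nonempty and $\mathcal{O}(X)$ denotes its Borel $\sigma$-algebra; $\delta_x$ is the Dirac measure at $x$. $\mathcal{B}(\mathcal{H})$ denotes the bounded operators on $\mathcal{H}$; the inner product is linear in the second variable. A positive operator valued measure (POVM) on $X$ with values in $\mathcal{B}(\mathcal{H})$ is a map $\mu:\mathcal{O}(X)\to\mathcal{B}(\mathcal{H})$ with $\mu(A)\ge 0$ for all $A$ and such that for all $h,k\in\mathcal{H}$ the map $\mu_{h,k}(A)=\langle h,\mu(A)k\rangle$ is a complex measure. It is normalized if $\mu(X)=I_{\mathcal{H}}$. $\mathcal{P}_{\mathcal{H}}(X)$ is the set of all normalized POVMs on $X$ with values in $\mathcal{B}(\mathcal{H})$. Bounded weak topology: a net $\mu^i$ of POVMs converges to a POVM $\mu$ if $\int_X f\,d\mu^i_{h,k}\to\int_X f\,d\mu_{h,k}$ for all bounded continuous functions $f:X\to\mathbb{C}$ and all $h,k\in\mathcal{H}$ (i.e. it is the smallest topology making all maps $\mu\mapsto\int_X f\,d\mu_{h,k}$ continuous). The $C^*$-convex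 hull of $\mathcal{M}\subseteq\mathcal{P}_{\mathcal{H}}(X)$ is the set of all $\sum_{i=1}^n T_i^*\mu_i(\cdot)T_i$ with $n\ge1$, $\mu_i\in\mathcal{M}$, $T_i\in\mathcal{B}(\mathcal{H})$ and $\sum_{i=1}^n T_i^*T_i=I_{\mathcal{H}}$. A normalized POVM $\mu$ is a $C^*$-extreme point in $\mathcal{P}_{\mathcal{H}}(X)$ if, whenever $\mu(\cdot)=\sum_{i=1}^n T_i^*\mu_i(\cdot)T_i$ with $\mu_i\in\mathcal{P}_{\mathcal{H}}(X)$ and invertible $T_i\in\mathcal{B}(\mathcal{H})$ satisfying $\sum_{i=1}^n T_i^*T_i=I_{\mathcal{H}}$, there are unitaries $U_i\in\mathcal{B}(\mathcal{H})$ such that $\mu_i(\cdot)=U_i^*\mu(\cdot)U_i$ for $1\le i\le n$. *)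

(* Defs.v *)
From HB Require Import structures.
From mathcomp Require Import all_boot all_order all_algebra.
From mathcomp Require Import complex.
From mathcomp Require Import all_classical all_reals all_analysis.

Set Implicit Arguments.
Unset Strict Implicit.
Unset Printing Implicit Defensive.

Import Order.TTheory GRing.Theory Num.Theory.
Import numFieldNormedType.Exports.
Local Open Scope classical_set_scope.
Local Open Scope complex_scope.
Local Open Scope ring_scope.

(* [R[i]^o] carries the topology of the modulus; [R[i]] itself has none in the
   library. *)
HB.instance Definition _ (R : rcfType) := NormedModule.copy R[i] R[i]^o.

(* The inner product is linear in its second argument. *)
HB.mixin Record CompleteNormedModule_isHilbert (R : realType) H
    of CompleteNormedModule R[i] H := {
  dotp : H -> H -> R[i] ;
  dotpP : forall h (a : R[i]) k l,
    dotp h (a *: k + l) = a * dotp h k + dotp h l ;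
  dotpC : forall h k, dotp k h = (dotp h k)^* ;
  dotp_norm : forall h, dotp h h = `|h| ^+ 2 }.

#[short(type="hilbertType")]
HB.structure Definition Hilbert (R : realType) :=
  { H of CompleteNormedModule_isHilbert R H & CompleteNormedModule R[i] H }.

Definition separable_space (T : topologicalType) :=
  exists2 D : set T, countable D & dense D.

Section complex_measures.
Context d (T : measurableType d) (R : realType).

Definition complex_sigma_additive (nu : set T -> R[i]) :=
  forall F : (set T)^nat, (forall n, measurable (F n)) -> trivIset setT F ->
  (\sum_(0 <= i < n) nu (F i)) @[n --> \oo] --> nu (\bigcup_n F n).

Record complex_measure := ComplexMeasure {
  complex_measure_fun :> set T -> R[i] ;
  complex_measure_sigma_additive : complex_sigma_additive complex_measure_fun }.

Definition charge_Re (nu : complex_measure) (A : set T) : \bar R :=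
  (complex.Re (nu A))%:E.

Definition charge_Im (nu : complex_measure) (A : set T) : \bar R :=
  (complex.Im (nu A))%:E.

Lemma continuous_Re : continuous (@complex.Re R).
Proof.
move=> z; apply/(@cvg_ballP R R _ _ (nbhs_filter z)) => e e0.
apply/nbhs_ballP; exists e%:C.
  by rewrite /= ltcR.
move=> w; rewrite /ball /= => zw; rewrite -ltcR.
by apply: le_lt_trans zw; rewrite -raddfB; exact: normc_ge_Re.
Qed.

Lemma continuous_Im : continuous (@complex.Im R).
Proof.
move=> z; apply/(@cvg_ballP R R _ _ (nbhs_filter z)) => e e0.
apply/nbhs_ballP; exists e%:C.
  by rewrite /= ltcR.
move=> w; rewrite /ball /= => zw; rewrite -ltcR.
apply: le_lt_trans zw; rewrite -raddfB; case: (z - w) => a b /=.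
by rewrite normc_def lecR -sqrtr_sqr ler_wsqrtr// lerDr sqr_ge0.
Qed.

Lemma complex_measure0 (nu : complex_measure) : nu set0 = 0.
Proof.
have := @complex_measure_sigma_additive nu (fun=> set0) (fun=> measurable0)
  (@trivIset_set0 _ _ _).
rewrite bigcup0// => nu0.
have nuS : \sum_(0 <= i < n.+1) nu set0 @[n --> \oo] --> nu set0.
  by rewrite (cvg_shiftS (fun n => \sum_(0 <= i < n) nu set0)).
have nuB : (\sum_(0 <= i < n.+1) nu set0 - \sum_(0 <= i < n) nu set0)
    @[n --> \oo] --> nu set0 - nu set0 by exact: cvgB.
have : nu set0 @[n --> \oo] --> (0 : R[i]).
  rewrite -[X in _ --> X](subrr (nu set0)); apply: cvg_trans nuB.
  apply: near_eq_cvg; near=> n.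
  by rewrite big_nat_recr//= addrAC subrr add0r.
move=> nuc0.
have nuc : nu set0 @[n --> \oo] --> nu set0 by exact: cvg_cst.
exact: (@cvg_unique _ (@norm_hausdorff _ _) _ _ _ _ nuc nuc0).
Unshelve. all: by end_near. Qed.

Section charges.
Variable nu : complex_measure.

Let charge_Re0 : charge_Re nu set0 = 0%E.
Proof. by rewrite /charge_Re complex_measure0. Qed.

Let charge_Re_fin A : measurable A -> charge_Re nu A \is a fin_num.
Proof. by []. Qed.

Let charge_Re_sigma_additive : semi_sigma_additive (charge_Re nu).
Proof.
move=> F mF tF _; under eq_fun do rewrite sumEFin.
apply: cvg_EFin; first by near=> n.
have FU := @complex_measure_sigma_additive nu _ mF tF.
have := cvg_comp _ _ FU (@continuous_Re _).
by apply: cvg_trans; apply: near_eq_cvg; near=> n; rewrite /= raddf_sum.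
Unshelve. all: by end_near. Qed.

HB.instance Definition _ := isCharge.Build d T R (charge_Re nu)
  charge_Re0 charge_Re_fin charge_Re_sigma_additive.

Let charge_Im0 : charge_Im nu set0 = 0%E.
Proof. by rewrite /charge_Im complex_measure0. Qed.

Let charge_Im_fin A : measurable A -> charge_Im nu A \is a fin_num.
Proof. by []. Qed.

Let charge_Im_sigma_additive : semi_sigma_additive (charge_Im nu).
Proof.
move=> F mF tF _; under eq_fun do rewrite sumEFin.
apply: cvg_EFin; first by near=> n.
have FU := @complex_measure_sigma_additive nu _ mF tF.
have := cvg_comp _ _ FU (@continuous_Im _).
by apply: cvg_trans; apply: near_eq_cvg; near=> n; rewrite /= raddf_sum.
Unshelve. all: by end_near. Qed.

HB.instance Definition _ := isCharge.Build d T R (charge_Im nu)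
  charge_Im0 charge_Im_fin charge_Im_sigma_additive.

End charges.

(* By [Hahn_decomposition_uniq] the value does not depend on the choice of the
   Hahn decomposition. *)
Definition charge_integral (nu : {charge set T -> \bar R}) (f : T -> R) : R :=
  let nuPN := projT2 (cid (projT2 (cid (Hahn_decomposition nu)))) in
  \int[jordan_pos nuPN]_x f x - \int[jordan_neg nuPN]_x f x.

Definition complex_integral (nu : complex_measure) (f : T -> R[i]) : R[i] :=
  (charge_integral (charge_Re nu) (@complex.Re R \o f)
   - charge_integral (charge_Im nu) (@complex.Im R \o f))
  +i* (charge_integral (charge_Re nu) (@complex.Im R \o f)
       + charge_integral (charge_Im nu) (@complex.Re R \o f)).

End complex_measures.

Section operators.
Context (R : realType) (H : hilbertType R).

Record bounded_operator := BoundedOperator {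
  bounded_operator_fun :> {linear H -> H} ;
  bounded_operatorP :
    exists M : R[i], forall h, `|bounded_operator_fun h| <= M * `|h| }.

HB.instance Definition _ := gen_eqMixin bounded_operator.
HB.instance Definition _ := gen_choiceMixin bounded_operator.

Implicit Types S T U : bounded_operator.

Definition is_adjoint T S := forall h k : H, dotp (S h) k = dotp h (T k).

(* The default value is never used: every bounded operator has exactly one
   adjoint, by the Riesz representation theorem. *)
Definition adjoint T : bounded_operator := xget T (is_adjoint T).

Definition positive_operator T := forall h : H, 0 <= dotp h (T h).

Definition invertible_operator T :=
  exists S, (forall h, S (T h) = h) /\ (forall h, T (S h) = h).

Definition unitary_operator U :=
  (forall h, adjoint U (U h) = h) /\ (forall h, U (adjoint U h) = h).

End operators.

Definition borel (X : ptopologicalType) := g_sigma_algebraType (@open X).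

HB.instance Definition _ (X : ptopologicalType) := Measurable.on (borel X).

Section povm.
Context (R : realType) (X : ptopologicalType) (H : hilbertType R).

(* As for the measures of the library, the values outside the Borel sets are
   irrelevant; accordingly, equalities of POVMs are stated on Borel sets. *)
Record povm := POVM {
  povm_fun :> set (borel X) -> bounded_operator H ;
  povm_ge0 : forall A, measurable A -> positive_operator (povm_fun A) ;
  povm_sigma_additive : forall h k,
    complex_sigma_additive (fun A => dotp h (povm_fun A k)) }.

Definition povm_measure (mu : povm) (h k : H) : complex_measure (borel X) R :=
  ComplexMeasure (@povm_sigma_additive mu h k).

Record normalized_povm := NormalizedPOVM {
  normalized_povm_val :> povm ;
  povm_setT : forall h, normalized_povm_val setT h = h }.

HB.instance Definition _ := gen_eqMixin normalized_povm.
HB.instance Definition _ := gen_choiceMixin normalized_povm.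

Record bounded_continuous := BoundedContinuous {
  bounded_continuous_fun :> X -> R[i] ;
  bounded_continuous_continuous : continuous bounded_continuous_fun ;
  bounded_continuous_bounded : bounded_fun bounded_continuous_fun }.

Definition povm_integral (i : bounded_continuous * H * H)
    (mu : normalized_povm) : R[i] :=
  complex_integral (povm_measure mu i.1.2 i.2) i.1.1.

Definition bounded_weak := sup_topology (fun i : bounded_continuous * H * H =>
  Topological.class (initial_topology (povm_integral i))).

HB.instance Definition _ := Topological.on bounded_weak.

Definition cstar_combination n (T : 'I_n -> bounded_operator H)
    (mus : 'I_n -> normalized_povm) (mu : normalized_povm) :=
  (forall h, \sum_(i < n) adjoint (T i) (T i h) = h) /\
  (forall A, measurable A -> forall h,
    mu A h = \sum_(i < n) adjoint (T i) (mus i A (T i h))).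

Definition cstar_convex_hull (M : set normalized_povm) : set normalized_povm :=
  [set mu : normalized_povm | exists n (T : 'I_n -> bounded_operator H)
      (mus : 'I_n -> normalized_povm),
    [/\ (0 < n)%N, forall i, M (mus i) & cstar_combination T mus mu]].

Definition cstar_extreme : set normalized_povm :=
  [set mu : normalized_povm | forall n (T : 'I_n -> bounded_operator H)
      (mus : 'I_n -> normalized_povm),
    (forall i, invertible_operator (T i)) -> cstar_combination T mus mu ->
    exists U : 'I_n -> bounded_operator H, forall i,
      unitary_operator (U i) /\
      forall A, measurable A -> forall h,
        mus i A h = adjoint (U i) (mu A (U i h))].

Definition dirac_spectral : set normalized_povm :=
  [set mu : normalized_povm | exists x : X, forall A, measurable A -> forall h,
    mu A h = ((\1_A x : R)%:C) *: h].

End povm.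

(* Main.v *)
From HB Require Import structures.
Require Import Defs.
From mathcomp Require Import all_boot all_order all_algebra.
From mathcomp Require Import complex.
From mathcomp Require Import all_classical all_reals all_analysis.
From mathcomp Require Import measurable_realfun ring lra.

(** A basic neighbourhood of a normalized POVM [mu] is given by finitely many
    test triples [(f, h, k)] and a tolerance.  Cut [X] into finitely many Borel
    cells [A_i] on which every [f] of the list oscillates by at most [delta]
    ([small_oscillation_partition]), and pick a point [x_i] in each cell.  For
    every normalized POVM [rho], the integral of [f] against [rho_{h,k}] differs
    from [\sum_i f(x_i) <h, rho(A_i) k>] by at most [8 delta |h| |k|], because
    the real and imaginary parts of [rho_{h,k}] are bounded by [|h| |k|] on each
    Borel set ([complex_quadrature], [povm_bounded]).  So it is enough to find
    [nu] in the C*-convex hull of the Dirac spectral measures with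
    [<h, nu(A_i) k> = <h, mu(A_i) k>] for all [i] and all vectors [h], [k] of the
    list ([povm_discretization]).

    The natural candidate [\sum_i mu(A_i)^{1/2} delta_{x_i} mu(A_i)^{1/2}] needs
    operator square roots.  These are avoided by using that only a finite list
    [vs] of vectors matters.  Let [P] be the orthogonal projection onto the span
    of [vs] and [Q = 1 - P].  A positive operator loses its part on the span by
    subtracting finitely many rank-one operators ([positive_peeling]: Cholesky
    elimination), so that each compression [P mu(A_i) P] is a finite sum of
    operators [|u><u|], and [\sum_i P mu(A_i) P = P].  Each [|u><u|] is [T^* T]
    with [T = |u><u| / |u|], and [Q = Q^* Q]; hence the operators [T], attached to
    the points [x_i], and [Q], attached to an arbitrary point, are the
    coefficients of a C*-convex combination of Dirac spectral measures, and
    [nu(A_i)] and [mu(A_i)] have the same compression to the span of [vs].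

    For the second density, a Dirac spectral measure is C*-extreme: if it is
    [\sum_i T_i^* mu_i T_i] with [T_i] invertible, then a Borel set that misses the
    point is null for the sum, hence for each positive summand, hence for each
    [mu_i]; so every [mu_i] is the same Dirac spectral measure.  That argument
    needs [T_i^*] to be a genuine adjoint, hence the Riesz representation
    theorem. *)

Set Implicit Arguments.
Unset Strict Implicit.
Unset Printing Implicit Defensive.

Import Order.TTheory GRing.Theory Num.Theory.
Import numFieldNormedType.Exports.
Local Open Scope classical_set_scope.
Local Open Scope complex_scope.
Local Open Scope ring_scope.

(** * Inner products and bounded operators *)

Section inner_product.
Context (R : realType) (H : hilbertType R).
Implicit Types (h k l : H) (a : R[i]).

Fact dotp_linear h : linear (dotp h : H -> R[i]).
Proof. exact: dotpP. Qed.
HB.instance Definition _ h :=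
  GRing.isLinear.Build R[i] H R[i] _ (dotp h) (@dotp_linear h).

Lemma dotpDr h k l : dotp h (k + l) = dotp h k + dotp h l.
Proof. exact: raddfD. Qed.
Lemma dotpBr h k l : dotp h (k - l) = dotp h k - dotp h l.
Proof. exact: raddfB. Qed.
Lemma dotpNr h k : dotp h (- k) = - dotp h k.
Proof. exact: raddfN. Qed.
Lemma dotp0r h : dotp h 0 = 0.
Proof. exact: raddf0. Qed.
Lemma dotpZr h a k : dotp h (a *: k) = a * dotp h k.
Proof. exact: linearZ. Qed.
Lemma dotp_sumr (I : Type) (r : seq I) (P : pred I) (F : I -> H) h :
  dotp h (\sum_(i <- r | P i) F i) = \sum_(i <- r | P i) dotp h (F i).
Proof. exact: raddf_sum. Qed.

Lemma dotpDl h k l : dotp (h + k) l = dotp h l + dotp k l.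
Proof. by rewrite dotpC dotpDr rmorphD/= -!dotpC. Qed.
Lemma dotpNl h k : dotp (- h) k = - dotp h k.
Proof. by rewrite dotpC dotpNr rmorphN/= -dotpC. Qed.
Lemma dotpBl h k l : dotp (h - k) l = dotp h l - dotp k l.
Proof. by rewrite dotpDl dotpNl. Qed.
Lemma dotp0l h : dotp 0 h = 0.
Proof. by rewrite dotpC dotp0r rmorph0. Qed.
Lemma dotpZl h a k : dotp (a *: h) k = a^* * dotp h k.
Proof. by rewrite dotpC dotpZr rmorphM/= -dotpC. Qed.

Lemma dotp_ge0 h : 0 <= dotp h h.
Proof. by rewrite dotp_norm exprn_ge0. Qed.

Lemma dotp_eq0 h : dotp h h = 0 -> h = 0.
Proof. by rewrite dotp_norm => /eqP; rewrite sqrf_eq0 normr_eq0 => /eqP. Qed.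

Lemma dotp_inj h k : (forall l, dotp l h = dotp l k) -> h = k.
Proof.
by move=> hk; apply/subr0_eq/dotp_eq0; rewrite dotpBr hk subrr.
Qed.

Lemma dotp_injl h k : (forall l, dotp h l = dotp k l) -> h = k.
Proof. by move=> hk; apply: dotp_inj => l; rewrite dotpC hk -dotpC. Qed.

End inner_product.


Section bounded_operators.
Context (R : realType) (H : hilbertType R).
Implicit Types (S T : bounded_operator H) (h k l : H).

(* Additivity and homogeneity with the structures of [H] itself: the generic
   lemmas leave terms in which an operator is wrapped as an additive map. *)
Lemma opD T h k : T (h + k) = T h + T k. Proof. exact: raddfD. Qed.
Lemma opB T h k : T (h - k) = T h - T k. Proof. exact: raddfB. Qed.
Lemma opZ T (a : R[i]) h : T (a *: h) = a *: T h. Proof. exact: linearZZ. Qed.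
Lemma op_sumr T (I : Type) (r : seq I) (P : pred I) (F : I -> H) :
  T (\sum_(i <- r | P i) F i) = \sum_(i <- r | P i) T (F i).
Proof. exact: raddf_sum. Qed.

(** Polarization over the complex field: the quadratic form is real at [h + k]
    and at [h + 'i *: k]. *)
Lemma positive_symmetric T : positive_operator T ->
  forall h k, dotp (T h) k = dotp h (T k).
Proof.
move=> T0 h k.
have Treal l : (dotp l (T l))^* = dotp l (T l).
  by apply/CrealP; rewrite ger0_real.
have E1 := Treal (h + k).
have E2 := Treal (h + 'i *: k).
move: E1 E2; rewrite !opD opZ !dotpDl !dotpDr !dotpZr !dotpZl.
rewrite !rmorphD/= !rmorphM/= !conjCK !conjCi.
rewrite !Treal -!dotpC.
move=> E1 E2.
have i2 : (2 * 'i : R[i]) != 0 by rewrite mulf_neq0// ?pnatr_eq0// neq0Ci.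
apply/eqP; rewrite -subr_eq0 -(mulrI_eq0 _ (mulfI i2)); apply/eqP.
move: E1 E2 => /eqP; rewrite -subr_eq0 => /eqP E1 /eqP; rewrite -subr_eq0 => /eqP E2.
transitivity ('i * (0 : R[i]) + 0); last by rewrite mulr0 addr0.
by rewrite -{1}E1 -E2; ring.
Qed.

(** The form is evaluated at [<k, T k> h - <T k, h> k]; when [<k, T k> = 0] that
    says nothing, and a large multiple of [k] is subtracted from [h] instead. *)
Lemma positive_CauchySchwarz T : positive_operator T ->
  forall h k, `|dotp h (T k)| ^+ 2 <= dotp h (T h) * dotp k (T k).
Proof.
move=> T0 h k.
have TC := positive_symmetric T0.
set p := dotp h (T h); set q := dotp k (T k); set b := dotp h (T k).
have pC : p^* = p by apply/CrealP; rewrite ger0_real// T0.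
have khE : dotp k (T h) = b^* by rewrite -dotpC TC.
have E (a c : R[i]) : a^* = a ->
    dotp (a *: h - c *: k) (T (a *: h - c *: k)) =
    a ^+ 2 * p - a * (c * b + (c * b)^*) + c * c^* * q.
  move=> aC; rewrite opB !opZ !dotpBl !dotpBr !dotpZl !dotpZr aC khE.
  by rewrite rmorphM /= -/p -/q -/b; ring.
have [q0|q0] := eqVneq q 0.
  suff -> : b = 0 by rewrite normr0 expr0n mulr_ge0// T0.
  apply/eqP/negP => /negP b0.
  have bb : 0 < `|b| ^+ 2 by rewrite exprn_gt0// normr_gt0.
  (* The coefficient makes the form equal to [p - 2 (p + 1) < 0]. *)
  have := T0 (1 *: h - ((p + 1) / `|b| ^+ 2 * b^*) *: k).
  rewrite E ?rmorph1// q0 mulr0 addr0 -mulrA [b^* * b]mulrC -normCK divfK ?gt_eqF//.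
  rewrite rmorphD/= rmorph1 pC expr1n !mul1r.
  rewrite (_ : p - _ = - (p + 2)); last by ring.
  by rewrite oppr_ge0 lt_geF// ltr_wpDl// T0.
have q_gt0 : 0 < q by rewrite lt_def q0 T0.
have qC : q^* = q by apply/CrealP; rewrite ger0_real// T0.
have := T0 (q *: h - b^* *: k).
rewrite (E _ _ qC) conjCK rmorphM/= conjCK [b^* * b]mulrC -normCK.
rewrite (_ : _ + _ = q * (p * q - `|b| ^+ 2)); last by ring.
by rewrite pmulr_rge0// subr_ge0.
Qed.

Lemma positive_eq0 T : positive_operator T ->
  forall h, dotp h (T h) = 0 -> T h = 0.
Proof.
move=> T0 h Th0; apply: dotp_inj => k; rewrite dotp0r.
apply/eqP; rewrite -normr_eq0 -sqrf_eq0; apply/eqP/le_anti.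
rewrite exprn_ge0// andbT (le_trans (positive_CauchySchwarz T0 k h))//.
by rewrite Th0 mulr0.
Qed.

End bounded_operators.

Section operations.
Context (R : realType) (H : hilbertType R).
Implicit Types (S T : bounded_operator H) (h k l : H).

Definition operator_of (f : H -> H) (lf : linear f)
    (bf : exists M : R[i], forall h, `|f h| <= M * `|h|) : bounded_operator H :=
  @BoundedOperator R H
    (HB.pack f (GRing.isLinear.Build R[i] H H *:%R f lf)) bf.

Fact op_id_linear : linear (@id H). Proof. by []. Qed.
Fact op_id_bounded : exists M : R[i], forall h, `|id h| <= M * `|h|.
Proof. by exists 1 => h; rewrite mul1r. Qed.
Definition op_id := operator_of op_id_linear op_id_bounded.

Fact op_add_linear S T : linear (fun h => S h + T h).
Proof. by move=> a h k; rewrite !opD !opZ scalerDr addrACA. Qed.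
Fact op_add_bounded S T :
  exists M : R[i], forall h, `|S h + T h| <= M * `|h|.
Proof.
have [[M SM] [N TN]] := (bounded_operatorP S, bounded_operatorP T).
exists (M + N) => h; rewrite mulrDl (le_trans (ler_normD _ _))//.
exact: lerD.
Qed.
Definition op_add S T := operator_of (@op_add_linear S T) (@op_add_bounded S T).

Fact op_scale_linear a T : linear (fun h => a *: T h).
Proof.
by move=> c h k; rewrite !opD !opZ scalerDr !scalerA mulrC.
Qed.
Fact op_scale_bounded a T :
  exists M : R[i], forall h, `|a *: T h| <= M * `|h|.
Proof.
have [M TM] := bounded_operatorP T.
by exists (`|a| * M) => h; rewrite normrZ -mulrA ler_wpM2l.
Qed.
Definition op_scale a T :=
  operator_of (@op_scale_linear a T) (@op_scale_bounded a T).

Fact op_comp_linear S T : linear (fun h => S (T h)).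
Proof. by move=> a h k; rewrite !(opD, opZ). Qed.
Fact op_comp_bounded S T : exists M : R[i], forall h, `|S (T h)| <= M * `|h|.
Proof.
have [[M SM] [N TN]] := (bounded_operatorP S, bounded_operatorP T).
exists (`|M| * N) => h; rewrite (le_trans (SM _))//.
(* [M] is a complex number, real only if some [T h] is nonzero. *)
have -> : M * `|T h| = `|M| * `|T h|.
  by rewrite -{2}[`|T h|]normr_id -normrM ger0_norm// (le_trans _ (SM _)).
by rewrite -mulrA ler_wpM2l.
Qed.
Definition op_comp S T :=
  operator_of (@op_comp_linear S T) (@op_comp_bounded S T).

Lemma op_id_positive : positive_operator op_id.
Proof. exact: dotp_ge0. Qed.

Lemma CauchySchwarz h k : `|dotp h k| <= `|h| * `|k|.
Proof.
have := positive_CauchySchwarz op_id_positive h k.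
by rewrite /= !dotp_norm -exprMn ler_pXn2r// nnegrE// mulr_ge0.
Qed.

Fact op_rank1_linear k l : linear ((fun h => dotp k h *: l) : H -> H).
Proof. by move=> a h h'; rewrite dotpDr dotpZr scalerDl scalerA. Qed.
Fact op_rank1_bounded k l :
  exists M : R[i], forall h, `|dotp k h *: l| <= M * `|h|.
Proof.
exists (`|l| * `|k|) => h; rewrite normrZ mulrC -mulrA.
by rewrite ler_wpM2l// CauchySchwarz.
Qed.
Definition op_rank1 k l :=
  operator_of (@op_rank1_linear k l) (@op_rank1_bounded k l).

(* The zero operator, the neutral element, is [0] times the identity. *)
Definition op_sum (I : Type) (r : seq I) (F : I -> bounded_operator H) :=
  \big[op_add/op_scale 0 op_id]_(i <- r) F i.

Lemma op_sumE (I : Type) (r : seq I) (F : I -> bounded_operator H) h :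
  op_sum r F h = \sum_(i <- r) F i h.
Proof.
rewrite /op_sum; elim: r => [|i r IH]; first by rewrite !big_nil /= scale0r.
by rewrite !big_cons /= IH.
Qed.

End operations.

(** * Rank-one decomposition on a finite list of vectors *)

Section peeling.
Context (R : realType) (H : hilbertType R).
Implicit Types (A B L : bounded_operator H) (v w x : H) (vs ws : seq H).

(** Cholesky elimination.  Subtracting [|A v><A v| / <v, A v>] from a positive [A]
    keeps it positive, by Cauchy-Schwarz, and makes it vanish at [v]; the vectors
    are treated one after the other.  The last clause records that the vectors
    [w] lie in the span of the vectors [A v]; it is phrased with operators [L], as
    their vanishing is all that is used of membership in a span. *)
Lemma positive_peeling vs A : positive_operator A ->
  exists ws B, [/\ forall x, A x = \sum_(w <- ws) dotp w x *: w + B x,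
    positive_operator B, {in vs, forall v, B v = 0} &
    forall L, {in vs, forall v, L (A v) = 0} -> {in ws, forall w, L w = 0}].
Proof.
elim: vs A => [|v vs IH] A A0.
  by exists [::], A; split=> // x; rewrite big_nil add0r.
have AC := positive_symmetric A0.
pose c := dotp v (A v).
have c0 : 0 <= c by exact: A0.
have cV0 : 0 <= c^-1 by rewrite invr_ge0.
(* If [c = 0] then [A v = 0] and [c^-1 = 0], so that the same formulas serve. *)
pose A1 := op_add A (op_scale (- c^-1) (op_rank1 (A v) (A v))).
have A1E x : A1 x = A x - c^-1 *: (dotp (A v) x *: A v).
  by rewrite /= scaleNr.
have A1v : A1 v = 0.
  rewrite A1E AC -/c scalerA.
  have [cz|cn0] := eqVneq c 0; last by rewrite mulVf// scale1r subrr.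
  by rewrite (positive_eq0 A0 cz) scaler0 subrr.
have A1_ge0 : positive_operator A1.
  move=> x; rewrite A1E dotpBr !dotpZr AC [dotp v _]dotpC AC.
  rewrite [_^* * _]mulrC -normCK subr_ge0.
  have [cz|cn0] := eqVneq c 0; first by rewrite cz invr0 mul0r A0.
  by rewrite ler_pdivrMl ?lt_def ?cn0// mulrC positive_CauchySchwarz.
have [ws [B [A1B B0 Bvs Lws]]] := IH _ A1_ge0.
pose w0 := (sqrtC c)^-1 *: A v.
exists (w0 :: ws), B; split=> //.
- move=> x; rewrite big_cons -addrA -A1B A1E /w0 dotpZl scalerA.
  rewrite [_ * dotp _ _]mulrC !scalerA.
  have -> : ((sqrtC c)^-1)^* = (sqrtC c)^-1.
    by apply/CrealP; rewrite ger0_real// invr_ge0 sqrtC_ge0.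
  rewrite -mulrA -invfM -expr2 sqrtCK [_ * c^-1]mulrC.
  by rewrite addrC subrK.
(* [0 <= B <= A1] as forms, so [B] vanishes where [A1] does. *)
- move=> u; rewrite inE => /predU1P[->|/Bvs//].
  apply: (positive_eq0 B0); apply/le_anti; rewrite B0 andbT.
  have := congr1 (dotp v) A1v; rewrite A1B dotpDr dotp0r => /eqP.
  rewrite addrC addr_eq0 => /eqP ->; rewrite oppr_le0 dotp_sumr sumr_ge0// => w _.
  by rewrite dotpZr [dotp v w]dotpC -normCK exprn_ge0.
- move=> L LA w; rewrite inE => /predU1P[->|].
    by rewrite opZ LA ?mem_head// scaler0.
  apply: Lws => u uvs; rewrite A1E opB !opZ LA ?inE ?uvs ?orbT//.
  by rewrite [L (A v)]LA ?mem_head// !scaler0 subrr.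
Qed.

(** Peeling the identity along [vs] leaves the projection [Q] onto the orthogonal
    complement of the span of [vs]; write [P = 1 - Q].  Peeling [A i] along a
    spanning list [es] of the range of [P] leaves an operator that is zero on that
    range, so [P (A i) P] is the sum of the [|P w><P w|], and these sum to
    [P \sum_i (A i) P = P]. *)
Lemma compression_factorization (I : finType) (A : I -> bounded_operator H) vs :
  (forall i, positive_operator (A i)) -> (forall x, \sum_i A i x = x) ->
  exists (Q : bounded_operator H) (us : I -> seq H),
    [/\ is_adjoint Q Q, forall x, Q (Q x) = Q x, {in vs, forall v, Q v = 0},
        forall x, \sum_i \sum_(u <- us i) dotp u x *: u + Q x = x &
        forall i, {in vs &, forall v v',
          \sum_(u <- us i) dotp v u * dotp u v' = dotp v (A i v')}].
Proof.
move=> A0 A1.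
have [es [Q [esQ Q0 Qvs Qes]]] := positive_peeling vs (@op_id_positive R H).
have {}esQ x : x = \sum_(w <- es) dotp w x *: w + Q x := esQ x.
have {}Qes w : w \in es -> Q w = 0 by apply: Qes => v /Qvs.
have QC := positive_symmetric Q0.
have QQ x : Q (Q x) = Q x.
  rewrite [in RHS](esQ x) opD op_sumr big1_seq ?add0r// => w /andP[_ wes].
  by rewrite opZ Qes// scaler0.
have /choice[f fP] i : exists p : seq H * bounded_operator H,
    [/\ forall x, A i x = \sum_(w <- p.1) dotp w x *: w + p.2 x,
        positive_operator p.2 & {in es, forall v, p.2 v = 0}].
  by have [ws [B [? ? ? _]]] := positive_peeling es (A0 i); exists (ws, B).
pose P x := x - Q x.
have PC x y : dotp (P x) y = dotp x (P y) by rewrite dotpBl dotpBr QC.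
have PP x : P (P x) = P x by rewrite /P opB QQ subrr subr0.
have PE x : P x = \sum_(w <- es) dotp w x *: w.
  by rewrite /P [X in X - _](esQ x) addrK.
have Pvs v : v \in vs -> P v = v by move=> /Qvs Qv; rewrite /P Qv subr0.
have fP0 i x : (f i).2 (P x) = 0.
  rewrite PE op_sumr big1_seq// => w /andP[_ wes].
  by have [_ _ fes] := fP i; rewrite opZ fes// scaler0.
have PAP i x : \sum_(u <- map P (f i).1) dotp u x *: u = P (A i (P x)).
  have [-> _ _] := fP i; rewrite fP0 addr0 big_map.
  rewrite {3}/P op_sumr -sumrB.
  by apply: eq_bigr => w _; rewrite PC opZ -scalerBr.
exists Q, (fun i => map P (f i).1); split => //.
- move=> x; under eq_bigr do rewrite PAP.
  have <- : P (P x) = \sum_i P (A i (P x)).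
    by rewrite -[in LHS](A1 (P x)) {1}/P op_sumr -sumrB.
  by rewrite PP /P subrK.
- move=> i v v' vvs v'vs.
  have := congr1 (dotp v) (PAP i v'); rewrite dotp_sumr => E.
  transitivity (dotp v (P (A i (P v')))).
    by rewrite -E; apply: eq_bigr => u _; rewrite dotpZr mulrC.
  by rewrite -PC !Pvs.
Qed.

End peeling.

(** * Riesz representation and adjoints *)

Section riesz.
Context (R : realType) (H : hilbertType R).
Implicit Types (h k l : H).

Section functional.
Variables (phi : H -> R[i]) (M : R[i]).
Hypothesis phi_linear : forall (a : R[i]) h k, phi (a *: h + k) = a * phi h + phi k.
Hypothesis phi_bounded : forall h, `|phi h| <= M * `|h|.

(* The Riesz vector is the minimizer of [J], which is real-valued. *)
Let J h : R[i] := `|h| ^+ 2 - (phi h + (phi h)^*).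

Let phiD h k : phi (h + k) = phi h + phi k.
Proof. by have := phi_linear 1 h k; rewrite scale1r mul1r. Qed.

Let phi0 : phi 0 = 0.
Proof.
by have /eqP := phiD 0 0; rewrite addr0 -subr_eq subrr eq_sym => /eqP.
Qed.

Let phiZ a h : phi (a *: h) = a * phi h.
Proof. by have := phi_linear a h 0; rewrite addr0 phi0 addr0. Qed.

Let phi_bounded_norm h : `|phi h| <= `|M| * `|h|.
Proof.
by rewrite -[`|h|]normr_id -normrM ger0_norm// (le_trans _ (phi_bounded h)).
Qed.

Let J_real h : J h \is Num.real.
Proof.
apply: realB; first by rewrite ger0_real// exprn_ge0.
by rewrite CrealE rmorphD/= conjCK addrC.
Qed.

Let J_lb h : - `|M| ^+ 2 <= J h.
Proof.
rewrite /J; set z := phi h + _.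
have : z <= 2 * (`|M| * `|h|).
  rewrite (@le_trans _ _ `|z|)//.
    by rewrite real_ler_norm// CrealE /z rmorphD/= conjCK addrC.
  rewrite (le_trans (ler_normD _ _))// norm_conjC mulr_natl mulr2n.
  by rewrite lerD// phi_bounded_norm.
move=> zM; rewrite lerBrDl -lerBrDr opprK (le_trans zM)//.
rewrite -subr_ge0 (_ : _ - _ = (`|h| - `|M|) ^+ 2); last by ring.
by rewrite real_exprn_even_ge0// rpredB// normr_real.
Qed.

(** The vectors that represent [phi] up to an error [e]: the near-minimizers of
    [J].  Any two of them are [2 e]-close, so these sets generate a Cauchy filter,
    whose limit represents [phi] exactly. *)
Definition approx_riesz (e : R[i]) : set H :=
  [set h | forall k, `|dotp h k - phi k| <= e * `|k|].

(** If [h] minimizes [J] up to [e ^+ 2], moving from [h] along [k] by the optimal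
    step decreases [J] by [|<h, k> - phi k| ^+ 2 / |k| ^+ 2], which is thus at most
    [e ^+ 2]. *)
Lemma approx_riesz_nonempty (e : R[i]) : 0 < e -> approx_riesz e !=set0.
Proof.
move=> e0.
pose Jr h : R := complex.Re (J h).
have JE h : J h = (Jr h)%:C by rewrite RRe_real.
have infJ : has_inf (range Jr).
  split; first by exists (Jr 0); exists 0.
  exists (complex.Re (- `|M| ^+ 2)) => _ [h _ <-].
  rewrite -lecR -JE RRe_real// rpredN rpredX// normr_real//.
have eE : e = (complex.Re e)%:C by rewrite RRe_real// gtr0_real.
have e2 : 0 < complex.Re e ^+ 2.
  by rewrite exprn_gt0// -ltcR -eE.
have [_ [h _ <-] hlt] := inf_adherent e2 infJ.
have Jh k : J h - e ^+ 2 < J k.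
  rewrite eE -rmorphXn/= !JE -rmorphB/= ltcR ltrBlDr.
  rewrite (lt_le_trans hlt)// lerD2r; apply: ge_inf; last by exists k.
  by case: infJ.
exists h => k.
have [->|k0] := eqVneq k 0; first by rewrite dotp0r phi0 subrr !normr0 mulr0.
have nk : 0 < `|k| ^+ 2 by rewrite exprn_gt0// normr_gt0.
set d := dotp h k - phi k.
have := Jh (h - (d^* / `|k| ^+ 2) *: k).
rewrite (_ : J (h - _) = J h - `|d| ^+ 2 / `|k| ^+ 2).
  move=> /ltW; rewrite lerD2l lerN2 ler_pdivrMr// -exprMn.
  by rewrite ler_pXn2r ?nnegrE// mulr_ge0// ltW.
set s := d^* / _.
have sd : s * d = `|d| ^+ 2 / `|k| ^+ 2 by rewrite normCK mulrAC [d * _]mulrC.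
have sdC : s^* * d^* = s * d.
  by rewrite -rmorphM sd; apply/CrealP/ger0_real; rewrite divr_ge0// ltW.
have ss : s^* * (s * `|k| ^+ 2) = s * d by rewrite -sdC /s divfK// gt_eqF.
have dC : d^* = (dotp h k)^* - (phi k)^* by rewrite rmorphB.
rewrite -sd /J phiD -scaleNr phiZ -!dotp_norm.
rewrite dotpDl !dotpDr !dotpZl !dotpZr [dotp k k]dotp_norm [dotp k h]dotpC.
have -> : (phi h + - s * phi k)^* = (phi h)^* - s^* * (phi k)^*.
  by rewrite rmorphD/= mulNr rmorphN/= rmorphM.
have -> : (- s)^* = - s^* by rewrite rmorphN.
move: ss sdC dC; rewrite /d; move: s^* => t ss sdC dC.
rewrite mulNr [- s * (`|k| ^+ 2)]mulNr !mulNr mulrN opprK ss.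
rewrite -{2}sdC dC; ring.
Qed.

Lemma approx_riesz_close (e : R[i]) h k : 0 <= e ->
  approx_riesz e h -> approx_riesz e k -> `|h - k| <= e *+ 2.
Proof.
move=> e0 he ke.
have [->|hk0] := eqVneq (h - k) 0; first by rewrite normr0 mulrn_wge0.
have nhk : 0 < `|h - k| by rewrite normr_gt0.
rewrite -(ler_pM2r nhk) -expr2 -dotp_norm -[X in X <= _]ger0_norm ?dotp_ge0//.
rewrite dotpBl -(subrKA (phi (h - k))) (le_trans (ler_normD _ _))//.
by rewrite mulrnAl mulr2n lerD// distrC.
Qed.

Theorem riesz_representation : exists y, forall h, phi h = dotp y h.
Proof.
pose F := filter_from [set e : R[i] | 0 < e] approx_riesz.
have FF : ProperFilter F.
  apply: filter_from_proper; last exact: approx_riesz_nonempty.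
  apply: filter_from_filter; first by exists 1; rewrite /= ltr01.
  move=> e e' /= e0 e'0; have ee' : 0 < e + e' by rewrite addr_gt0.
  (* [e] and [e'] are complex; half their harmonic mean is below both. *)
  exists (e * e' / (e + e')); first by rewrite /= divr_gt0// mulr_gt0.
  move=> h hee'; split=> k; rewrite (le_trans (hee' k))// ler_wpM2r//.
    by rewrite ler_pdivrMr// ler_wpM2l ?(ltW e0)// lerDr ltW.
  by rewrite ler_pdivrMr// mulrC ler_wpM2l ?(ltW e'0)// lerDl ltW.
have /cauchy_cvg/cvg_ex[y Fy] : cauchy F.
  apply/cauchy_ballP => e e0; near_simpl.
  have e40 : 0 < e / 4 by rewrite divr_gt0.
  exists (approx_riesz (e / 4), approx_riesz (e / 4)).
    by split; exists (e / 4).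
  move=> [h k] /= [he ke]; rewrite -ball_normE /ball_ /=.
  rewrite (le_lt_trans (approx_riesz_close (ltW e40) he ke))//.
  rewrite -subr_gt0 (_ : _ - _ = e / 2) ?divr_gt0//.
  by field.
exists y => h; apply/eqP; apply/negPn/negP; rewrite -subr_eq0 -normr_gt0 => z0.
set z := `| _ | in z0.
have h1 : 0 < `|h| + 1 by rewrite ltr_wpDl.
have e0 : 0 < z / (2 * (`|h| + 1)) by rewrite divr_gt0// mulr_gt0.
set e := z / _ in e0.
have Fe : F (approx_riesz e) by exists e.
have [k [yk ke]] := @filter_ex _ _ FF _ (filterI (Fy _ (nbhsx_ballx y e e0)) Fe).
move: yk; rewrite -ball_normE /ball_ /= => /ltW yk.
have : z <= e * `|h| + e * `|h|.
  rewrite /z distrC -(subrKA (dotp k h)) (le_trans (ler_normD _ _))// lerD//.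
  by rewrite -dotpBl (le_trans (CauchySchwarz _ _))// ler_wpM2r.
apply/negP; rewrite -real_ltNge; last 2 first.
- by rewrite ger0_real// addr_ge0// mulr_ge0// ltW.
- by rewrite ger0_real// ltW.
rewrite -subr_gt0 (_ : _ - _ = e * 2) ?mulr_gt0//.
by rewrite {1}/e /e; field; rewrite gt_eqF.
Qed.

End functional.

Lemma adjoint_exists (T : bounded_operator H) : exists S, is_adjoint T S.
Proof.
have [M TM] := bounded_operatorP T.
have M0 h : `|T h| <= `|M| * `|h|.
  by rewrite -[`|h|]normr_id -normrM ger0_norm// (le_trans _ (TM h)).
have /choice[S SP] k : exists y, forall h, dotp k (T h) = dotp y h.
  apply: (@riesz_representation _ (`|k| * `|M|)).
    by move=> a h l; rewrite opD opZ dotpDr dotpZr.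
  by move=> h; rewrite (le_trans (CauchySchwarz _ _))// -mulrA ler_wpM2l.
have lS : linear S.
  move=> a h k; apply: dotp_injl => l.
  by rewrite -SP !(dotpDl, dotpZl) -!SP.
have bS : exists N : R[i], forall h, `|S h| <= N * `|h|.
  exists `|M| => h.
  have [->|Sh0] := eqVneq (S h) 0; first by rewrite normr0 mulr_ge0.
  have nSh : 0 < `|S h| by rewrite normr_gt0.
  rewrite -(ler_pM2r nSh) -expr2 -dotp_norm -SP.
  rewrite -[X in X <= _]ger0_norm; last by rewrite SP dotp_ge0.
  rewrite (le_trans (CauchySchwarz _ _))// mulrC mulrAC ler_wpM2r//.
exists (operator_of lS bS) => h k; exact/esym/SP.
Qed.

Lemma adjointP (T : bounded_operator H) h k :
  dotp (adjoint T h) k = dotp h (T k).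
Proof.
rewrite /adjoint; case: xgetP => [S _ ->//|nT].
by have [S TS] := adjoint_exists T; case: (nT S).
Qed.

Lemma adjoint_unique (T S : bounded_operator H) :
  is_adjoint T S -> adjoint T =1 S.
Proof. by move=> TS h; apply: dotp_injl => k; rewrite adjointP TS. Qed.

Lemma dotp_adjoint (T : bounded_operator H) h k :
  dotp h (adjoint T k) = dotp (T h) k.
Proof. by rewrite dotpC adjointP -dotpC. Qed.

End riesz.

(** * Normalized POVMs and C*-convex combinations *)

Section complex_additivity.
Context d (T : measurableType d) (R : realType).
Implicit Types (nu : complex_measure T R).

Lemma complex_measureU nu (A B : set T) : measurable A -> measurable B ->
  A `&` B = set0 -> nu (A `|` B) = nu A + nu B.
Proof.
move=> mA mB AB0; apply/eqP; rewrite eq_complex; apply/andP; split.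
  have := @chargeU _ _ _ (charge_Re nu) A B mA mB AB0.
  by rewrite /charge_Re -EFinD => -[->]; rewrite raddfD.
have := @chargeU _ _ _ (charge_Im nu) A B mA mB AB0.
by rewrite /charge_Im -EFinD => -[->]; rewrite raddfD.
Qed.

Lemma complex_measure_partition (I : finType) (idx : T -> I) nu :
  (forall i, measurable (idx @^-1` [set i])) ->
  nu setT = \sum_i nu (idx @^-1` [set i]).
Proof.
move=> midx.
have H (r : seq I) : uniq r -> measurable (idx @^-1` [set` r]) /\
    nu (idx @^-1` [set` r]) = \sum_(i <- r) nu (idx @^-1` [set i]).
  elim: r => [_|i r IH /= /andP[ir /IH[mr nur]]].
    by rewrite set_nil preimage_set0 big_nil complex_measure0.
  have -> : [set` i :: r] = [set i] `|` [set` r].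
    by apply/seteqP; split=> j /=; rewrite inE => /predU1P.
  rewrite preimage_setU; split; first exact: measurableU.
  rewrite complex_measureU// ?nur ?big_cons// -preimage_setI.
  rewrite (_ : _ `&` _ = set0) ?preimage_set0//.
  by apply/seteqP; split=> // j [/= -> /=]; rewrite (negbTE ir).
have [_ <-] := H _ (index_enum_uniq I); congr (nu _).
by apply/seteqP; split=> // x _ /=; rewrite mem_index_enum.
Qed.

Lemma complex_sigma_additive_sum (I : Type) (r : seq I)
    (nu : I -> set T -> R[i]) : (forall i, complex_sigma_additive (nu i)) ->
  complex_sigma_additive (fun A => \sum_(i <- r) nu i A).
Proof.
move=> nuS F mF tF; elim: r => [|i r IH].
  rewrite big_nil; under eq_fun do under eq_bigr do rewrite big_nil.
  by under eq_fun do rewrite big1//; exact: cvg_cst.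
rewrite big_cons.
rewrite (_ : (fun n => _) = (fun n => \sum_(0 <= m < n) nu i (F m) +
    \sum_(0 <= m < n) \sum_(j <- r) nu j (F m))).
  by apply: cvgD; [exact: nuS|exact: IH].
apply/funext => n; rewrite -big_split/=; apply: eq_bigr => m _.
by rewrite big_cons.
Qed.

Lemma dirac_complex_sigma_additive (x : T) (c : R[i]) :
  complex_sigma_additive (fun A : set T => (\1_A x : R)%:C * c).
Proof.
move=> F mF tF.
have [[n _ Fnx]|nFx] := pselect ((\bigcup_n F n) x).
  rewrite indicE mem_set; last by exists n.
  rewrite mul1r; apply: cvg_near_cst; near=> m.
  rewrite big_mkord.
  have nm : (n < m)%N by near: m; exists n.+1.
  rewrite (bigD1 (Ordinal nm))//= indicE mem_set// mul1r big1 ?addr0// => i /eqP ni.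
  rewrite indicE memNset ?mul0r// => Fix.
  apply: ni; apply: val_inj => /=; apply: (tF i n) => //.
  by exists x.
rewrite indicE memNset// mul0r; apply: cvg_near_cst; near=> m.
rewrite big1// => i _; rewrite indicE memNset ?mul0r// => Fix.
by apply: nFx; exists i.
Unshelve. all: by end_near. Qed.

End complex_additivity.

Section povms.
Context (R : realType) (X : ptopologicalType) (H : hilbertType R).
Implicit Types (mu : normalized_povm X H) (A : set (borel X)) (h k : H).

Lemma povmC mu A h : measurable A -> mu A h + mu (~` A) h = h.
Proof.
move=> mA; apply: dotp_inj => l; rewrite dotpDr.
have /= <- := @complex_measureU _ _ _ (povm_measure mu l h) A (~` A) mA
  (measurableC mA) (setICr A).
by rewrite setUCr povm_setT.
Qed.

Lemma povm_le1 mu A h : measurable A -> dotp h (mu A h) <= `|h| ^+ 2.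
Proof.
move=> mA; rewrite -dotp_norm -[X in _ <= dotp _ X](povmC mu h mA) dotpDr lerDl.
by rewrite (povm_ge0 mu (measurableC mA)).
Qed.

(** Cauchy-Schwarz for the positive operator [mu A], which is at most the
    identity since its complement [mu (~` A)] is positive. *)
Lemma povm_bounded mu A h k : measurable A ->
  `|dotp h (mu A k)| <= `|h| * `|k|.
Proof.
move=> mA; have mu0 := povm_ge0 mu mA.
rewrite -ler_sqr ?nnegrE ?mulr_ge0// exprMn.
rewrite (le_trans (positive_CauchySchwarz mu0 _ _))//.
by rewrite ler_pM ?povm_le1// mu0.
Qed.

Lemma cstar_combination_exists n (T : 'I_n -> bounded_operator H)
    (mus : 'I_n -> normalized_povm X H) :
  (forall h, \sum_(i < n) adjoint (T i) (T i h) = h) ->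
  exists mu, cstar_combination T mus mu.
Proof.
move=> T1.
pose f A := op_sum (index_enum 'I_n)
  (fun i => op_comp (adjoint (T i)) (op_comp (mus i A) (T i))).
have fE A h : f A h = \sum_(i < n) adjoint (T i) (mus i A (T i h)).
  by rewrite op_sumE.
have dotpf A h k :
    dotp h (f A k) = \sum_(i < n) dotp (T i h) (mus i A (T i k)).
  by rewrite fE dotp_sumr; apply: eq_bigr => i _; rewrite dotp_adjoint.
have f0 A : measurable A -> positive_operator (f A).
  by move=> mA h; rewrite dotpf sumr_ge0// => i _; rewrite (povm_ge0 (mus i) mA).
have fS h k : complex_sigma_additive (fun A => dotp h (f A k)).
  under eq_fun do rewrite dotpf.
  apply: (complex_sigma_additive_sum _
    (nu := fun i A => dotp (T i h) (mus i A (T i k)))) => i.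
  exact: povm_sigma_additive.
have fT h : POVM f0 fS setT h = h.
  by rewrite /= fE -[RHS]T1; apply: eq_bigr => i _; rewrite povm_setT.
by exists (NormalizedPOVM fT); split.
Qed.

Lemma dirac_spectral_exists (x : X) : exists mu : normalized_povm X H,
  forall A, measurable A -> forall h, mu A h = ((\1_A x : R)%:C) *: h.
Proof.
pose f A := op_scale ((\1_A x : R)%:C) (op_id H).
have f0 A : measurable A -> positive_operator (f A).
  move=> mA h; rewrite /= dotpZr mulr_ge0 ?dotp_ge0//.
  by rewrite lecR indicE ler0n.
have fS h k : complex_sigma_additive (fun A => dotp h (f A k)).
  rewrite /=; under eq_fun do rewrite dotpZr.
  exact: dirac_complex_sigma_additive.
have fT h : POVM f0 fS setT h = h by rewrite /= indicT scale1r.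
by exists (NormalizedPOVM fT).
Qed.

(** The unitaries can be taken to be the identity: every component equals the
    given Dirac spectral measure. *)
Lemma dirac_cstar_extreme :
  @dirac_spectral R X H `<=` @cstar_extreme R X H.
Proof.
move=> mu [x mux] n T mus Tinv [T1 muT].
have mus0 i A : measurable A -> ~ A x -> forall h, mus i A h = 0.
  move=> mA nAx h.
  have [S [_ TS]] := Tinv i; rewrite -(TS h).
  move: (S h) => {}h.
  apply: (positive_eq0 (povm_ge0 (mus i) mA)).
  have := congr1 (dotp h) (muT A mA h).
  rewrite mux// indicE memNset// scale0r dotp0r dotp_sumr => /esym/eqP.
  rewrite psumr_eq0; last first.
    by move=> j _; rewrite dotp_adjoint (povm_ge0 (mus j) mA).
  by move=> /allP/(_ i); rewrite mem_index_enum dotp_adjoint => /(_ isT)/eqP.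
have adj1 h : adjoint (op_id H) h = h by exact: (@adjoint_unique _ _ _ (op_id H)).
exists (fun=> op_id H) => i; split; first by split => h; rewrite /= adj1.
move=> A mA h; rewrite adj1/= mux//.
have [Ax|nAx] := pselect (A x); last first.
  by rewrite mus0// indicE memNset// scale0r.
rewrite indicE mem_set// scale1r -[RHS](povmC (mus i) _ mA).
by rewrite (mus0 _ (~` A)) ?addr0//; exact: measurableC.
Qed.

End povms.

(** * Riemann sums for charges and complex measures *)

Section complex_parts.
Context (R : realType).
Implicit Types z w : R[i].

Lemma normc_ge_Im z : `|complex.Im z|%:C <= `|z|.
Proof.
case: z => a b; rewrite normc_def lecR -sqrtr_sqr ler_wsqrtr//.
by rewrite lerDr sqr_ge0.
Qed.

Lemma normc_le_ReIm z : `|z| <= (`|complex.Re z| + `|complex.Im z|)%:C.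
Proof.
rewrite [z in X in X <= _]complexE (le_trans (ler_normD _ _))//.
rewrite rmorphD/= normrM lerD//.
  by rewrite normc_def/= expr0n addr0 sqrtr_sqr.
by rewrite !normc_def/= !(expr0n, expr1n, addr0, add0r, sqrtr1) sqrtr_sqr mul1r.
Qed.

Lemma ReM z w :
  complex.Re (z * w) = complex.Re z * complex.Re w - complex.Im z * complex.Im w.
Proof. by case: z w => [a b] [c d]. Qed.

Lemma ImM z w :
  complex.Im (z * w) = complex.Re z * complex.Im w + complex.Im z * complex.Re w.
Proof. by case: z w => [a b] [c d]. Qed.

End complex_parts.

Section quadrature.
Context d (T : measurableType d) (R : realType) (I : finType) (idx : T -> I).
Hypothesis midx : forall i, measurable (idx @^-1` [set i]).

Let stepE (c : I -> R) x :
  c (idx x) = \sum_i c i * \1_(idx @^-1` [set i]) x.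
Proof.
rewrite (bigD1 (idx x))//= indicE mem_set// mulr1 big1 ?addr0// => i /eqP ix.
by rewrite indicE memNset ?mulr0//= => /esym.
Qed.

Section measure_quadrature.
Variable mu : {finite_measure set T -> \bar R}.

Let mu_lty A : measurable A -> (mu A < +oo)%E.
Proof. by move=> mA; rewrite ltey_eq fin_num_measure. Qed.

Let integrable_cell i : mu.-integrable setT (EFin \o \1_(idx @^-1` [set i])).
Proof. by apply: integrable_indic; rewrite ?setIT ?mu_lty. Qed.

Lemma measure_quadrature (f : T -> R) (c : I -> R) (e : R) :
  measurable_fun setT f -> (forall x, `|f x - c (idx x)| <= e) ->
  `|\int[mu]_x f x - \sum_i c i * fine (mu (idx @^-1` [set i]))|
    <= e * fine (mu setT).
Proof.
move=> mf fce.
have icell i : mu.-integrable setT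
    (fun x => (c i * \1_(idx @^-1` [set i]) x)%:E).
  have := integrableZl measurableT (c i) (integrable_cell i).
  by apply: eq_integrable => // x _; rewrite /= EFinM.
have istep : mu.-integrable setT (EFin \o (c \o idx)).
  rewrite (_ : _ \o _ = (fun x => \sum_(i <- index_enum I)
      (c i * \1_(idx @^-1` [set i]) x)%:E)%E).
    exact: integrable_sum.
  by apply/funext => x /=; rewrite stepE sumEFin.
have stepint : \int[mu]_x (c (idx x)) =
    \sum_i c i * fine (mu (idx @^-1` [set i])).
  rewrite /Rintegral; under eq_integral do rewrite stepE -sumEFin.
  rewrite integral_sum// -sum_fine; last first.
    by move=> i _; exact: integrable_fin_num.
  apply: eq_bigr => i _.
  rewrite -[LHS]/(\int[mu]_x (c i * \1_(idx @^-1` [set i]) x)) RintegralZl//.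
  by rewrite /Rintegral integral_indic// setIT.
have mstep : measurable_fun setT (c \o idx) by case/integrableP: istep => /measurable_EFinP.
have idiff : mu.-integrable setT (EFin \o (fun x => f x - c (idx x))).
  apply: measurable_bounded_integrable => //; first exact: mu_lty.
    exact: measurable_funB.
  by exists e; split; [exact: num_real|move=> M eM x _ /=; rewrite (le_trans (fce x))// ltW].
have iff : mu.-integrable setT (EFin \o f).
  have := integrableD measurableT idiff istep.
  by apply: eq_integrable => // x _; rewrite /= -EFinD subrK.
rewrite -stepint -RintegralB// (le_trans (le_normr_Rintegral _ _))//.
rewrite -Rintegral_cst//; apply: le_Rintegral => //.
  exact: (integrable_norm idiff).
by apply: finite_measure_integrable_cst.
Qed.

End measure_quadrature.

(** The two Jordan parts are the restrictions of [nu] and [- nu] to the sets of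
    the Hahn decomposition, so each has total mass at most [C]. *)
Lemma jordan_quadrature (nu : {charge set T -> \bar R}) (P N : set T)
    (nuPN : hahn_decomposition nu P N) (f : T -> R) (c : I -> R) (e C : R) :
  0 <= e -> measurable_fun setT f -> (forall x, `|f x - c (idx x)| <= e) ->
  (forall A, measurable A -> `|fine (nu A)| <= C) ->
  `|\int[jordan_pos nuPN]_x f x - \int[jordan_neg nuPN]_x f x
    - \sum_i c i * fine (nu (idx @^-1` [set i]))| <= e * C *+ 2.
Proof.
move=> e0 mf fce nuC.
have [[mP _] [mN _] _ _] := nuPN.
pose p := jordan_pos nuPN; pose n := jordan_neg nuPN.
have nuE A : measurable A -> fine (nu A) = fine (p A) - fine (n A).
  move=> mA; rewrite (jordan_decomp nuPN mA) /cadd /= cscaleN1 fineD//.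
  - by rewrite fineN.
  - exact: fin_num_measure.
  - by rewrite fin_numN; exact: fin_num_measure.
have pT : fine (p setT) <= C.
  rewrite /p jordan_posE cjordan_posE /crestr0 mem_set// /crestr setTI.
  by rewrite (le_trans (ler_norm _))// nuC.
have nT : fine (n setT) <= C.
  rewrite /n jordan_negE cjordan_negE /crestr0 mem_set// /crestr setTI.
  by rewrite fineN (le_trans (ler_norm _))// normrN nuC.
under eq_bigr do rewrite nuE// mulrBr.
rewrite sumrB [- (_ - _)]opprD addrACA -opprD.
rewrite (le_trans (ler_normB _ _))// mulr2n lerD//.
- by rewrite (le_trans (measure_quadrature p mf fce))// ler_wpM2l.
- by rewrite (le_trans (measure_quadrature n mf fce))// ler_wpM2l.
Qed.

Lemma charge_quadrature (nu : {charge set T -> \bar R}) (f : T -> R)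
    (c : I -> R) (e C : R) : 0 <= e ->
  measurable_fun setT f -> (forall x, `|f x - c (idx x)| <= e) ->
  (forall A, measurable A -> `|fine (nu A)| <= C) ->
  `|charge_integral nu f - \sum_i c i * fine (nu (idx @^-1` [set i]))|
    <= e * C *+ 2.
Proof. exact: jordan_quadrature. Qed.

(** Four real quadratures, for the real and imaginary parts of [nu] and [f], each
    contributing an error [2 e C]. *)
Lemma complex_quadrature (nu : complex_measure T R) (f : T -> R[i])
    (c : I -> R[i]) (e C : R) : 0 <= e ->
  measurable_fun setT (@complex.Re R \o f) ->
  measurable_fun setT (@complex.Im R \o f) ->
  (forall x, `|complex.Re (f x) - complex.Re (c (idx x))| <= e) ->
  (forall x, `|complex.Im (f x) - complex.Im (c (idx x))| <= e) ->
  (forall A, measurable A -> `|nu A| <= C%:C) ->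
  `|complex_integral nu f - \sum_i c i * nu (idx @^-1` [set i])|
    <= (e * C *+ 8)%:C.
Proof.
move=> e0 mRe mIm fRe fIm nuC.
have Re_le A : measurable A -> `|fine (charge_Re nu A)| <= C.
  by move=> mA; rewrite -lecR (le_trans (normc_ge_Re _))// nuC.
have Im_le A : measurable A -> `|fine (charge_Im nu A)| <= C.
  by move=> mA; rewrite -lecR (le_trans (normc_ge_Im _))// nuC.
pose cRe i := complex.Re (c i); pose cIm i := complex.Im (c i).
have RR := charge_quadrature (c := cRe) e0 mRe fRe Re_le.
have RI := charge_quadrature (c := cIm) e0 mIm fIm Re_le.
have IR := charge_quadrature (c := cRe) e0 mRe fRe Im_le.
have II := charge_quadrature (c := cIm) e0 mIm fIm Im_le.
rewrite (le_trans (normc_le_ReIm _))// lecR.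
rewrite !raddfB/=.
pose q (a : I -> R) (m : set T -> \bar R) :=
  \sum_i a i * fine (m (idx @^-1` [set i])).
have -> : complex.Re (\sum_i c i * nu (idx @^-1` [set i])) =
    q cRe (charge_Re nu) - q cIm (charge_Im nu).
  by rewrite raddf_sum -sumrB; apply: eq_bigr => i _; exact: ReM.
have -> : complex.Im (\sum_i c i * nu (idx @^-1` [set i])) =
    q cRe (charge_Im nu) + q cIm (charge_Re nu).
  by rewrite raddf_sum -big_split; apply: eq_bigr => i _; exact: ImM.
rewrite [q cRe (charge_Im nu) + _]addrC.
rewrite [- (q cRe _ - _)]opprD addrACA -opprD.
rewrite [- (q cIm _ + _)]opprD [X in _ + `|X|]addrACA.
rewrite (_ : _ *+ 8 = (e * C *+ 2 + e * C *+ 2) + (e * C *+ 2 + e * C *+ 2)).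
  by rewrite lerD// (le_trans (ler_normB _ _), le_trans (ler_normD _ _))// lerD.
by rewrite -!mulrnDr.
Qed.

End quadrature.

(** * Finite partitions and discretization *)

Section partition.
Context d (T : measurableType d) (R : realType).

(** The cells are the preimages of consecutive intervals of length [e]. *)
Lemma small_oscillation_partition1 (f : T -> R) (M e : R) : 0 < e ->
  measurable_fun setT f -> (forall x, `|f x| <= M) ->
  exists (I : finType) (idx : T -> I),
    (forall i, measurable (idx @^-1` [set i])) /\
    (forall x y, idx x = idx y -> `|f x - f y| <= e).
Proof.
move=> e0 mf fM.
pose g x := (f x + M) / e.
have g0 x : 0 <= g x.
  apply: divr_ge0; last exact: ltW.
  by have := fM x; rewrite ler_norml => /andP[*]; lra.
pose N := Num.truncn ((M + M) / e).
have gN x : (Num.truncn (g x) < N.+1)%N.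
  rewrite ltnS le_truncn// ler_pM2r ?invr_gt0// lerD2r.
  by rewrite (le_trans (ler_norm _)).
exists 'I_N.+1, (fun x => Ordinal (gN x)); split=> [i|x y [gxy]].
  rewrite (_ : _ @^-1` _ = f @^-1` `[i%:R * e - M, i.+1%:R * e - M[).
    by rewrite -[_ @^-1` _]setTI; apply: mf.
  apply/seteqP; split=> x /=; rewrite in_itv/= lerBlDr ltrBrDr.
    move=> /(congr1 val)/= /eqP; rewrite truncn_eq// /g.
    by rewrite ler_pdivlMr// ltr_pdivrMr.
  rewrite -ler_pdivlMr// -ltr_pdivrMr// -(truncn_eq _ (g0 x)) => /eqP gi.
  exact: val_inj.
have /andP[xl xr] := truncn_itv (g0 x).
have /andP[yl yr] := truncn_itv (g0 y).
move: xl xr yl yr; rewrite gxy; move: (Num.truncn (g y)) => n.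
rewrite (_ : n.+1%:R = n%:R + 1); last by rewrite natr1.
rewrite /g !(ler_pdivlMr, ltr_pdivrMr)// !mulrDl !mul1r.
by move=> *; rewrite ler_norml; apply/andP; split; lra.
Qed.

(** Common refinement: the index types are multiplied. *)
Lemma small_oscillation_partition (J : eqType) (s : seq J) (f : J -> T -> R) (e : R) :
  0 < e -> (forall j, measurable_fun setT (f j)) ->
  (forall j, exists M, forall x, `|f j x| <= M) ->
  exists (I : finType) (idx : T -> I),
    (forall i, measurable (idx @^-1` [set i])) /\
    (forall x y, idx x = idx y -> {in s, forall j, `|f j x - f j y| <= e}).
Proof.
move=> e0 mf bf; elim: s => [|j s [I [idx [midx idxP]]]].
  exists unit, (fun=> tt); split=> // -[].
  rewrite (_ : _ @^-1` _ = setT); first exact: measurableT.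
  by apply/seteqP; split.
have [M fM] := bf j.
have [K [kdx [mkdx kdxP]]] := small_oscillation_partition1 e0 (mf j) fM.
exists (I * K)%type, (fun x => (idx x, kdx x)); split.
  move=> [i k].
  rewrite (_ : _ @^-1` _ = idx @^-1` [set i] `&` kdx @^-1` [set k]).
    exact: measurableI.
  by apply/seteqP; split=> x /= [-> ->].
move=> x y [ixy kxy] l; rewrite inE => /predU1P[->|]; first exact: kdxP.
exact: idxP.
Qed.

End partition.

Section continuous_borel.
Context (R : realType) (X : ptopologicalType).

Lemma continuous_borel_measurable (f : X -> R) :
  continuous f -> measurable_fun setT (f : borel X -> R).
Proof.
move=> /continuousP cf; apply: (measurability _ (RGenOpens.measurableE R)).
move=> _ [_ [a [b -> <-]]]; rewrite setTI.
apply: sub_sigma_algebra; apply: cf; exact: interval_open.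
Qed.

End continuous_borel.

Section discretization.
Context (R : realType) (X : ptopologicalType) (H : hilbertType R).
Implicit Types (mu nu : normalized_povm X H) (h k v : H).

(** The list form suits coefficients that come as a list of lists; each operator
    is paired with the point that carries its Dirac measure. *)
Lemma dirac_hull_of_seq (s : seq (bounded_operator H * X)) : (0 < size s)%N ->
  (forall h, \sum_(p <- s) adjoint p.1 (p.1 h) = h) ->
  exists2 nu, cstar_convex_hull (@dirac_spectral R X H) nu &
    forall (A : set (borel X)), measurable A -> forall h k,
      dotp h (nu A k) = \sum_(p <- s) (\1_A p.2 : R)%:C * dotp (p.1 h) (p.1 k).
Proof.
move=> s0 s1.
have /choice[delta deltaP] (x : X) : exists mu : normalized_povm X H,
  forall A, measurable A -> forall h, mu A h = ((\1_A x : R)%:C) *: h.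
  exact: dirac_spectral_exists.
pose t := in_tuple s.
pose T i := (tnth t i).1; pose mus i := delta (tnth t i).2.
have T1 h : \sum_(i < size s) adjoint (T i) (T i h) = h.
  by rewrite -[RHS]s1 [in RHS](big_tnth _ _ s).
have [nu nuP] := cstar_combination_exists mus T1.
exists nu; first by exists (size s), T, mus; split=> // i; exists (tnth t i).2; exact: deltaP.
move=> A mA h k; have [_ ->] := nuP => //.
rewrite [in RHS](big_tnth _ _ s) dotp_sumr; apply: eq_bigr => i _.
by rewrite dotp_adjoint /mus deltaP// dotpZr.
Qed.

(** The operator is [|u><u| / |u|]; the formula also holds for [u = 0]. *)
Lemma rank1_factorization (u : H) : exists T : bounded_operator H,
  (forall h, adjoint T (T h) = dotp u h *: u) /\
  (forall h k, dotp (T h) (T k) = dotp h u * dotp u k).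
Proof.
pose T := op_scale (`|u|^-1) (op_rank1 u u).
have TC : is_adjoint T T.
  move=> h k; rewrite /= !dotpZl !dotpZr -dotpC [dotp u k * _]mulrC.
  by congr (_ * _); apply/CrealP; rewrite ger0_real// invr_ge0.
have TT h : T (T h) = dotp u h *: u.
  rewrite /= !dotpZr dotp_norm !scalerA.
  have [->|u0] := eqVneq u 0; first by rewrite !scaler0.
  by congr (_ *: _); field; rewrite normr_eq0.
exists T; split=> [h|h k]; first by rewrite (adjoint_unique TC) TT.
by rewrite TC TT dotpZr mulrC.
Qed.

(** Each operator [|u><u|] occurring in the compression of [mu (cell i)] is put at
    a point of that cell.  For an empty cell the point is arbitrary, and harmless
    because [mu] vanishes there. *)
Lemma povm_discretization mu (I : finType) (idx : borel X -> I) (vs : seq H) :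
  (forall i, measurable (idx @^-1` [set i])) ->
  exists2 nu, cstar_convex_hull (@dirac_spectral R X H) nu &
    forall i, {in vs &, forall h k,
      dotp h (nu (idx @^-1` [set i]) k) = dotp h (mu (idx @^-1` [set i]) k)}.
Proof.
move=> midx; pose cell i := idx @^-1` [set i].
have mu1 x : \sum_i mu (cell i) x = x.
  apply: dotp_inj => l; rewrite dotp_sumr.
  have /= <- := complex_measure_partition (povm_measure mu l x) midx.
  by rewrite povm_setT.
have [Q [us [QC QQ Qvs usQ usA]]] := compression_factorization vs
  (fun i => povm_ge0 mu (midx i)) mu1.
have /choice[S SP] := rank1_factorization.
pose pt i : X := xget point (cell i).
pose s := (Q, point : X) :: [seq (S u, pt i) | i <- index_enum I, u <- us i].
have [//||nu nuhull nuE] := @dirac_hull_of_seq s.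
  move=> h; rewrite big_cons big_allpairs_dep/= (adjoint_unique QC) QQ.
  rewrite -[RHS]usQ addrC; congr (_ + _); apply: eq_bigr => i _.
  by apply: eq_bigr => u _; have [->] := SP u.
exists nu => // i h k hvs kvs.
rewrite nuE; last exact: midx.
rewrite big_cons big_allpairs_dep/= Qvs// dotp0l mulr0 add0r.
transitivity (\sum_j (\1_(cell i) (pt j) : R)%:C * dotp h (mu (cell j) k)).
  apply: eq_bigr => j _; rewrite -usA// big_distrr/=; apply: eq_bigr => u _.
  by have [_ ->] := SP u.
have pt_in x : cell (idx x) (pt (idx x)) by exact: (@xgetI X point (cell (idx x)) x erefl).
have cell0 j : ~ (exists x, cell j x) -> dotp h (mu (cell j) k) = 0.
  move=> j0; have -> : cell j = set0.
    by apply/seteqP; split=> // x xj; apply: j0; exists x.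
  exact: (complex_measure0 (povm_measure mu h k)).
rewrite (bigD1 i)//= [X in _ + X]big1 ?addr0 => [|j /eqP ji].
  have [[x xi]|/cell0->] := pselect (exists x, cell i x); last by rewrite mulr0.
  by rewrite indicE mem_set ?mul1r// -xi; exact: pt_in.
have [[x xj]|/cell0->] := pselect (exists x, cell j x); last by rewrite mulr0.
rewrite indicE memNset ?mul0r// => ptj; apply: ji.
by rewrite -xj; have := pt_in x; rewrite /cell/= => <-; rewrite xj.
Qed.

End discretization.

(** * Density in the bounded weak topology *)

(* Membership in a list of tests needs a decidable equality. *)
HB.instance Definition _ (R : realType) (X : ptopologicalType) :=
  gen_eqMixin (bounded_continuous R X).

Section density.
Context (R : realType) (X : ptopologicalType) (H : hilbertType R).
Implicit Types (mu nu : normalized_povm X H).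

Local Notation test := (bounded_continuous R X * H * H)%type.

(** Both [mu] and the discretized [nu] are within [8 delta C] of the same Riemann
    sum. *)
Lemma dirac_hull_approximation mu (s : seq test) (e : R) : 0 < e ->
  exists2 nu, cstar_convex_hull (@dirac_spectral R X H) nu &
    {in s, forall i, `|povm_integral i mu - povm_integral i nu| <= e%:C}.
Proof.
move=> e0.
pose K (i : test) : R[i] := `|i.1.2| * `|i.2|.
have K0 i : 0 <= K i by rewrite mulr_ge0.
pose C : R := complex.Re (\sum_(i <- s) K i) + 1.
have CE : C%:C = \sum_(i <- s) K i + 1.
  by rewrite rmorphD/= RRe_real// ger0_real// sumr_ge0.
have C0 : 0 < C by rewrite -ltcR CE ltr_wpDl// sumr_ge0.
have KC i : i \in s -> K i <= C%:C.
  move=> si; rewrite CE (big_rem i)//= -addrA lerDl addr_ge0//.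
  exact: sumr_ge0.
pose delta := e / (C *+ 16).
have delta0 : 0 < delta by rewrite divr_gt0// pmulrn_lgt0.
pose F (j : test * bool) (x : borel X) : R :=
  if j.2 then complex.Re (j.1.1.1 x) else complex.Im (j.1.1.1 x).
have mF j : measurable_fun setT (F j).
  case: j => -[[f h] k] []; apply: continuous_borel_measurable => x.
    exact: (continuous_comp (@bounded_continuous_continuous _ _ f x) (@continuous_Re _ _)).
  exact: (continuous_comp (@bounded_continuous_continuous _ _ f x) (@continuous_Im _ _)).
have bF j : exists M, forall x, `|F j x| <= M.
  case: j => -[[f h] k] b.
  have [M0 [_ fM0]] := @bounded_continuous_bounded _ _ f.
  pose M := M0 + 1; exists (complex.Re M) => x.
  have fxM : `|f x| <= M by apply: fM0 => //; rewrite ltrDl.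
  have ME : M = (complex.Re M)%:C by rewrite RRe_real// ger0_real// (le_trans _ fxM).
  rewrite -lecR -ME (le_trans _ fxM)// /F; case: b => /=.
    exact: normc_ge_Re.
  exact: normc_ge_Im.
have [I [idx [midx idxP]]] := small_oscillation_partition
  [seq (i, b) | i <- s, b <- [:: true; false]] delta0 mF bF.
pose vs := [seq i.1.2 | i <- s] ++ [seq i.2 | i <- s].
have [nu nuhull nuE] := povm_discretization mu vs midx.
exists nu => // -[[f h] k] fs.
pose pt i : X := xget point (idx @^-1` [set i]).
have ptE x : idx x = idx (pt (idx x)).
  by apply/esym; exact: (@xgetI X point (idx @^-1` [set idx x]) x erefl).
have quad rho : `|povm_integral (f, h, k) rho -
    \sum_i f (pt i) * dotp h (rho (idx @^-1` [set i]) k)| <= (delta * C *+ 8)%:C.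
  apply: (@complex_quadrature _ _ _ _ _ midx (povm_measure rho h k) f (f \o pt)).
  - exact: ltW.
  - exact: (mF ((f, h, k), true)).
  - exact: (mF ((f, h, k), false)).
  - move=> x; apply: (idxP _ _ (ptE x) ((f, h, k), true)).
    by apply: allpairs_f => //; rewrite !inE.
  - move=> x; apply: (idxP _ _ (ptE x) ((f, h, k), false)).
    by apply: allpairs_f => //; rewrite !inE.
  - by move=> A mA; rewrite (le_trans (povm_bounded rho h k mA))// (KC _ fs).
rewrite -(subrKA (\sum_i f (pt i) * dotp h (mu (idx @^-1` [set i]) k))).
rewrite (le_trans (ler_normD _ _))//.
rewrite (_ : e = delta * C *+ 8 + delta * C *+ 8); last first.
  by rewrite /delta; field; rewrite gt_eqF.
rewrite rmorphD lerD//=.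
rewrite distrC; have := quad nu; congr (is_true (`|_ - _| <= _)).
apply: eq_bigr => i _; rewrite nuE// mem_cat.
  by rewrite (map_f (fun i : test => i.1.2) fs).
by rewrite (map_f (fun i : test => i.2) fs) orbT.
Qed.

(** The approximants of [mu] in [S] form a filter base indexed by finite lists of
    tests and tolerances.  It converges to [mu] for each initial topology, hence
    for their supremum, so every open set around [mu] meets [S]. *)
Lemma dense_bounded_weak (S : set (normalized_povm X H)) :
  (forall mu (s : seq test) (e : R), 0 < e -> exists2 nu, S nu &
     {in s, forall i, `|povm_integral i mu - povm_integral i nu| <= e%:C}) ->
  dense (S : set (bounded_weak X H)).
Proof.
move=> Sapprox O [mu Omu] oO.
pose B (p : seq test * R) : set (normalized_povm X H) := [set nu | S nu /\
  {in p.1, forall i, `|povm_integral i mu - povm_integral i nu| <= p.2%:C}].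
pose F := filter_from [set p : seq test * R | 0 < p.2] B.
have FF : ProperFilter F.
  apply: filter_from_proper; last first.
    by move=> [s e] /= /(Sapprox mu s)[nu ? ?]; exists nu.
  apply: filter_from_filter; first by exists ([::], 1) => /=.
  move=> [s e] [s' e'] /= e0 e'0; exists (s ++ s', Num.min e e').
    by rewrite /= lt_min e0.
  move=> nu [/= Snu nuP]; split; split=> // i si.
    rewrite (le_trans (nuP i _)) ?mem_cat ?si// lecR ge_min lexx//.
  by rewrite (le_trans (nuP i _)) ?mem_cat ?si ?orbT// lecR ge_min lexx orbT.
have Fmu : F --> (mu : bounded_weak X H).
  apply/cvg_sup => i U [/= _ [[V /= oV <- /= Vmu]]] /filterS; apply.
  have /nbhs_ballP[e /= e0 eV] : nbhs (povm_integral i mu) V by exact: open_nbhs_nbhs.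
  have eE : e = (complex.Re e)%:C by rewrite RRe_real// gtr0_real.
  have Re0 : 0 < complex.Re e by rewrite -ltcR -eE.
  have e20 : 0 < complex.Re e / 2 by rewrite divr_gt0.
  exists ([:: i], complex.Re e / 2) => // nu [_ nuP]; apply: eV.
  rewrite -ball_normE /ball_/= (le_lt_trans (nuP i (mem_head _ _)))//.
  by rewrite [ltRHS]eE ltcR/=; lra.
have FS : F S by exists ([::], 1) => [|nu []//]; exact: ltr01.
have FO : F O by apply: Fmu; exact: open_nbhs_nbhs.
exact: (@filter_ex _ _ FF _ (filterI FO FS)).
Qed.

End density.

Theorem theorem6p15 (R : realType) (X : ptopologicalType) (H : hilbertType R)
    (hX : hausdorff_space X) (hH : separable_space H) :
  dense (cstar_convex_hull (@dirac_spectral R X H) : set (bounded_weak X H)) /\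
  dense (cstar_convex_hull (@cstar_extreme R X H) : set (bounded_weak X H)).
Proof.
split; apply: dense_bounded_weak => mu s e e0.
  exact: dirac_hull_approximation.
have [nu [n [T [mus [n0 musP nuP]]]] nus] := dirac_hull_approximation mu s e0.
exists nu => //; exists n, T, mus; split=> // i.
exact/dirac_cstar_extreme/musP.
Qed.
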